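(* Let $2\le a<b$ be integers and let $\mathfrak F_{a,b}$ be the tree defined in the context. Let $\mathcal M$ and $\mathcal N$ be the centred and the uncentred Hardy--Littlewood maximal operators on $\mathfrak F_{a,b}$. The following hold: (i) $\mathcal N$ is unbounded on $L^p(\mathfrak F_{a,b})$ for all $p$ in $[1,\infty)$; (ii) $\mathcal M$ is bounded on $L^p(\mathfrak F_{a,b})$ whenever $p\in(1,\infty)$, and it is of weak type $(1,1)$.
   Context: A tree is a connected graph with no loops (cycles), identified with its set of vertices; the valence of a vertex is its number of neighbours. A tree carries the graph distance $d$ and the counting measure $\mu$; $|E|:=\mu(E)$, and $B_r(x):=\{y: d(x,y)\le r\}$. With $\mathbb N=\{0,1,2,\dots\}$, $$\mathcal M f(x):=\sup_{r\in\mathbb N}\frac1{|B_r(x)|}\int_{B_r(x)}|f|\,d\mu,\qquad \mathcal N f(x):=\sup_{B\ni x}\frac1{|B|}\int_B|f|\,d\mu,$$ where the second supremum is over all balls $B$ (of any centre and any radius in $\mathbb N$) containing $x$. The tree $\mathfrak F_{a,b}$: it has a reference vertex $o$ with $a+1$ neighbours $g_0,\dots,g_a$; the vertex $g_0$ and all the vertices lying on geodesics starting with the edge $[o,g_0]$ (other than $o$) have valence $b+1$; the vertices $g_1,\dots,g_a$ and all the vertices lying on geodesics starting with $[o,g_j]$ for some $j\in\{1,\dots,a\}$ have valence $a+1$. Lebesgue spaces are with respect to the counting measure. Weak type $(1,1)$ means that there is a constant $C$ such that $|\{\mathcal M f>\lambda\}|\le C\lambda^{-1}\|f\|_{L^1}$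 for all $\lambda>0$ and all $f\in L^1$. *)

(* Defs.v *)
From HB Require Import structures.
From mathcomp Require Import all_boot all_order all_algebra.
From mathcomp Require Import all_classical all_reals all_analysis.

Set Implicit Arguments.
Unset Strict Implicit.
Unset Printing Implicit Defensive.

Import Order.TTheory GRing.Theory Num.Theory.

Local Open Scope classical_set_scope.
Local Open Scope ring_scope.

Record tree (V : choiceType) := Tree {
  adj :> rel V;
  adj_sym : symmetric adj;
  adj_irr : irreflexive adj;
  (* any two vertices are joined by a walk [x :: s], which has [size s] edges *)
  tree_connected : forall x y : V, exists n : nat,
    `[< exists s : seq V, [/\ path adj x s, last x s = y & size s = n] >];
  tree_acyclic : forall s : seq V, (2 < size s)%N -> ~ ucycle adj s }.

Section graph.
Variables (V : choiceType) (t : tree V).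

Definition gdist (x y : V) : nat := ex_minn (tree_connected t x y).

Definition gball (r : nat) (x : V) : set V := [set y | (gdist x y <= r)%N].

Definition has_valence (x : V) (k : nat) : Prop := ([set y | t x y] #= `I_k)%card.

(* [x :: s] is a geodesic segment issuing from [x] *)
Definition geodesic (x : V) (s : seq V) : Prop :=
  path t x s /\ gdist x (last x s) = size s.

(* the vertices other than [x] on the geodesics starting with the edge [x, y];
   a vertex on an infinite geodesic also lies on a finite one *)
Definition branch (x y : V) : set V :=
  [set z | exists s : seq V, geodesic x (y :: s) /\ z \in y :: s].

(* [t] is the tree F_{a,b} with reference vertex [o], whose neighbours are
   [g 0], ..., [g a]; this determines [t] up to isomorphism *)
Definition is_Fab (a b : nat) (o : V) (g : 'I_a.+1 -> V) : Prop :=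
  [/\ injective g,
      [set x | t o x] = range g,
      (forall x, branch o (g ord0) x -> has_valence x b.+1)
    & (forall j, j != ord0 ->
         forall x, branch o (g j) x -> has_valence x a.+1)].

End graph.

Arguments is_Fab {V} t a b o g.

(* the vertex set with its power set as sigma-algebra *)
Definition discrete (V : pointedType) : Type := V.

Section discrete.
Variable V : pointedType.

HB.instance Definition _ := Pointed.on (discrete V).
HB.instance Definition _ := @isMeasurable.Build default_measure_display
  (discrete V) discrete_measurable discrete_measurable0
  discrete_measurableC discrete_measurableU.

End discrete.

Local Open Scope ereal_scope.

Section maximal_operators.
Context {R : realType} {V : pointedType}.

Definition card_measure : {measure set (discrete V) -> \bar R} := counting.

Local Notation mu := card_measure.

Definition avg (f : discrete V -> R) (E : set (discrete V)) : \bar R :=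
  (mu E)^-1 * \int[mu]_(y in E) `|(f y)%:E|.

Variable t : tree V.

Definition centred_max (f : discrete V -> R) (x : discrete V) : \bar R :=
  ereal_sup [set avg f (gball t r x) | r in [set: nat]].

Definition uncentred_max (f : discrete V -> R) (x : discrete V) : \bar R :=
  ereal_sup [set avg f (gball t zr.2 zr.1) |
    zr in [set zr : V * nat | gball t zr.2 zr.1 x]].

End maximal_operators.

Section boundedness.
Context {R : realType} {V : pointedType}.
Local Notation mu := (@card_measure R V).

Variable T : (discrete V -> R) -> discrete V -> \bar R.

Definition bounded_on_Lp (p : R) : Prop :=
  exists C : R, forall f : discrete V -> R, f \in Lfun mu p%:E ->
    'N[mu]_p%:E[T f] <= C%:E * 'N[mu]_p%:E[EFin \o f].

Definition weak_type_1_1 : Prop :=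
  exists C : R, forall (f : discrete V -> R) (lambda : R),
    f \in Lfun mu 1 -> (0 < lambda)%R ->
    mu [set x | lambda%:E < T f x] <= (C / lambda)%R%:E * 'N[mu]_1[EFin \o f].

End boundedness.

(* Main.v *)
Require Import Defs.
From mathcomp Require Import all_boot all_order all_algebra.
From mathcomp Require Import all_classical all_reals all_analysis.
From mathcomp Require Import zify ring lra.
Import Order.TTheory GRing.Theory Num.Theory.

Set Implicit Arguments.
Unset Strict Implicit.
Unset Printing Implicit Defensive.

(** Root the tree at [o].  Acyclicity gives every other vertex a unique parent,
    and two vertices [x], [y] at distance at most [r] have a common ancestor
    lying [i] generations above [x] and [j] generations above [y] with
    [i + j <= r] ([gball_confluent]).  The vertices other than [o] split into
    the branch through [g ord0], where everyone has [b] children, and its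
    complement, where everyone has [a] children.

    _The centred operator._  The estimate is made separately on these two sets.
    It only uses, for a set [Q] of vertices and an integer [k >= 2], that every
    vertex of the tree has at most [k ^ i] descendants of generation [i] in [Q]
    and that [|B_r(x)| >= k ^ r] for [x] in [Q].  On the branch through [g ord0]
    this holds with [k = b], because no vertex of the tree has more than [b]
    children (the root has [a + 1 <= b]).  On the complement it holds with
    [k = a]: balls there may be much larger than [a ^ r] when they reach the
    branch of degree [b + 1], which only helps, and the points at which the
    maximal function is evaluated stay in a set that grows like [a ^ i].

    Given these two properties, let [g_j(z)] be the sum of [|f|] over the
    generation [j] below [z].  The mean of [|f|] over [B_r(x)] is at most the sum
    of [k^(-r) g_j(z)] over the ancestors [z] of [x], say [i] generations above,
    and over the [j <= r - i].  If this exceeds [lambda], then for some [i], [j]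
    one has [k ^ i < c_j g_j(z)] with [c_j = (6 / lambda) (3 / (2 k)) ^ j].
    For given [z] and [j], the number of such [x] is at most the sum of the
    [k ^ i < c_j g_j(z)], hence at most [2 c_j g_j(z)].  The sum over [z] is at
    most [2 c_j ||f||_1] since every vertex has only one ancestor at each height,
    and the [c_j] have sum [O(1 / lambda)].  This is [weak_type_core].

    The bounds on [L^p] for [1 < p] follow by interpolation with the trivial bound
    on bounded functions, in the dyadic form [dyadic_interpolation].

    _The uncentred operator._  Let [E] be the generation [k] below [g ord0], so
    that [|E| = b ^ k].  A ball centred outside this branch at level [m + 1], of
    radius [r = m + k + 2], contains [E] and has at most
    [4 a ^ r + 2 b ^ k] points.  If [k] is the least integer with [a ^ r <= b ^ k],
    the mean of the indicator of [E] over such balls is at least [1 / 6], whereas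
    these balls contain all vertices at distance [r] below their centres, at least
    [a ^ (m + r) >= (m / b) |E|] points in total ([uncentred_witness]).  As [m] is
    arbitrary, no [L^p] bound with finite [p] can hold.

    The combinatorial arguments are about sums over finite duplicate-free lists of
    vertices; [card_measure_le], [sum_le_integral] and [integral_le] translate them
    into statements about the counting measure. *)

Local Open Scope classical_set_scope.

(** * Levels, parents and common ancestors in a rooted tree *)

Section rooted_tree.
Local Open Scope nat_scope.
Variables (V : choiceType) (t : tree V) (o : V).

Lemma gdist_path x s : path t x s -> gdist t x (last x s) <= size s.
Proof.
move=> ps; rewrite /gdist; case: ex_minnP => m _; apply.
by apply/asboolP; exists s.
Qed.

Lemma gdistP x y : exists s, [/\ path t x s, last x s = y & size s = gdist t x y].
Proof. by rewrite /gdist; case: ex_minnP => m /asboolP[s sP] _; exists s. Qed.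

Definition level x := gdist t o x.

Lemma level_root : level o = 0.
Proof. by apply/eqP; rewrite -leqn0; exact: (@gdist_path o [::]). Qed.

Lemma level_eq0 x : (level x == 0) = (x == o).
Proof.
apply/eqP/eqP => [|->]; last exact: level_root.
rewrite /level; have [s [_ <- <-]] := gdistP o x.
by move/eqP; rewrite size_eq0 => /eqP ->.
Qed.

Lemma level_adj x y : t x y -> level y <= (level x).+1.
Proof.
move=> xy; have [s [ps ls ss]] := gdistP o x.
have := @gdist_path o (rcons s y); rewrite rcons_path ps ls xy last_rcons.
by rewrite size_rcons ss; exact.
Qed.

Lemma parent_exists x : x != o -> exists y, t x y /\ level x = (level y).+1.
Proof.
rewrite -level_eq0; have [s [ps ls ss]] := gdistP o x.
elim/last_ind: s ps ls ss => [_ _|s y _].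
  by rewrite -/(level x) => <-.
rewrite rcons_path last_rcons size_rcons => /andP[ps sy] yx.
rewrite yx in sy; move=> ss _; exists (last o s); split; first by rewrite adj_sym.
apply/eqP; rewrite eqn_leq level_adj//= /level -ss ltnS.
exact: gdist_path.
Qed.

(** The lines of ancestors of two distinct vertices of the same level stay
    disjoint until they first meet; following one up and the other down gives a
    path which an edge between [u] and [v], or a common neighbour of higher level,
    would close into a cycle. *)
Lemma path_below n u v : u != v -> level u = n -> level v = n ->
  exists s, [/\ path t u (rcons s v), uniq s, all (fun w => level w < n) s
              & 0 < size s].
Proof.
elim: n u v => [|n IH] u v uv lu lv.
  move/eqP: lu lv uv; rewrite level_eq0 => /eqP -> /eqP.
  by rewrite level_eq0 eq_sym => ->.
have uo : u != o by rewrite -level_eq0 lu.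
have vo : v != o by rewrite -level_eq0 lv.
have [u' [uu']] := parent_exists uo; rewrite lu => -[lu'].
have [v' [vv']] := parent_exists vo; rewrite lv => -[lv'].
have [u'v'|u'v'] := eqVneq u' v'.
  exists [:: u']; split=> //=; last by rewrite -lu' ltnSn.
  by rewrite uu' andbT u'v' adj_sym.
have [s [ps us ls _]] := IH _ _ u'v' (esym lu') (esym lv').
have ns w : level w = n -> w \notin s.
  by move=> lw; apply/negP => /(allP ls); rewrite lw ltnn.
exists (u' :: rcons s v'); split => //.
- by rewrite /= uu' rcons_path ps last_rcons adj_sym vv'.
- by rewrite /= mem_rcons rcons_uniq inE negb_or u'v' us !ns.
- rewrite /= all_rcons -lu' -lv' !ltnSn /=; by apply/allP => w /(allP ls) /ltnW.
Qed.

Lemma level_adj_neq x y : t x y -> level x != level y.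
Proof.
move=> xy; apply/eqP => lxy.
have xDy : x != y by apply: contraTneq xy => ->; rewrite adj_irr.
have [s [ps us ls s0]] := path_below xDy erefl (esym lxy).
have ns w : level w = level x -> w \notin s.
  by move=> lw; apply/negP => /(allP ls); rewrite lw ltnn.
apply: (@tree_acyclic _ t (x :: rcons s y)).
  by rewrite /= size_rcons !ltnS.
apply/andP; split.
  by rewrite /= rcons_path ps last_rcons adj_sym.
by rewrite /= mem_rcons inE rcons_uniq negb_or xDy us !ns.
Qed.

Lemma parent_unique x y z : t x y -> t x z ->
  level x = (level y).+1 -> level x = (level z).+1 -> y = z.
Proof.
move=> xy xz ly lz; apply/eqP/negPn/negP => yz.
have lyz : level z = level y by move: ly lz => -> -[].
have [s [ps us ls s0]] := path_below yz erefl lyz.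
have ns w : level y <= level w -> w \notin s.
  by move=> lw; apply/negP => /(allP ls); rewrite ltnNge lw.
apply: (@tree_acyclic _ t (x :: y :: rcons s z)).
  by rewrite /= size_rcons !ltnS.
apply/andP; split.
  by rewrite /= xy rcons_path ps last_rcons adj_sym.
have xNy : x != y by apply: contraTneq xy => ->; rewrite adj_irr.
have xNz : x != z by apply: contraTneq xz => ->; rewrite adj_irr.
rewrite /= !inE !mem_rcons !inE rcons_uniq !negb_or xNy xNz yz us !ns//.
- by rewrite lyz.
- by rewrite ly.
Qed.

(** The default value makes the root its own parent. *)
Definition parent x := xget o [set y | t x y /\ level x = (level y).+1].

Lemma parentP x : x != o -> t x (parent x) /\ level x = (level (parent x)).+1.
Proof.
by move=> xo; rewrite /parent; case: xgetP => // h; have [y] := parent_exists xo;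
  move/h.
Qed.

Lemma parentE x y : t x y -> level x = (level y).+1 -> parent x = y.
Proof.
move=> xy lxy; have xo : x != o by rewrite -level_eq0 lxy.
by have [xp lxp] := parentP xo; exact: parent_unique xp xy lxp lxy.
Qed.

(** [descendant i z x]: the vertex [z] is the ancestor of [x] that lies [i]
    generations above [x]. *)
(** The condition on levels discards the iterates of [parent] that have already
    reached the root. *)
Definition descendant i z x := (iter i parent x == z) && (level x == level z + i).

Lemma descendant0 z x : descendant 0 z x = (x == z).
Proof.
rewrite /descendant /= addn0; apply/andP/eqP => [[/eqP]//|->].
by rewrite !eqxx.
Qed.

Lemma descendant1 z x : descendant 1 z x = (x != o) && (parent x == z).
Proof.
rewrite /descendant /= addn1 andbC; have [->|xo] := eqVneq x o.
  by rewrite level_root.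
have [_ ->] := parentP xo; rewrite eqSS /=.
by have [->|] := eqVneq (parent x) z; rewrite ?eqxx// andbF.
Qed.

Lemma level_iter_parent i x : i <= level x -> level (iter i parent x) = level x - i.
Proof.
elim: i x => [|i IH] x ix; first by rewrite subn0.
have xo : x != o by rewrite -level_eq0 -lt0n (leq_trans _ ix).
have [_ lx] := parentP xo.
have pix : i <= level (parent x) by rewrite lx in ix.
by rewrite iterSr IH// lx subSS.
Qed.

Lemma descendant_iter i x : i <= level x -> descendant i (iter i parent x) x.
Proof. by move=> ix; rewrite /descendant eqxx level_iter_parent// subnK ?eqxx. Qed.

Lemma descendant_level i z x : descendant i z x -> level x = level z + i.
Proof. by case/andP => _ /eqP. Qed.

Lemma descendant_iterE i z x : descendant i z x -> iter i parent x = z.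
Proof. by case/andP => /eqP. Qed.

Lemma descendant_add i j z y x :
  descendant i z y -> descendant j y x -> descendant (j + i) z x.
Proof.
move=> /andP[/eqP iy /eqP ly] /andP[/eqP jx /eqP lx].
by rewrite /descendant addnC iterD jx iy eqxx lx ly addnA eqxx.
Qed.

Lemma descendant_split i j z x :
  descendant (i + j) z x -> descendant i z (iter j parent x) /\
  descendant j (iter j parent x) x.
Proof.
move=> /andP[/eqP iz /eqP lx].
have jx : j <= level x by rewrite lx addnA leq_addl.
split; last exact: descendant_iter.
rewrite /descendant -iterD iz eqxx level_iter_parent//=.
by rewrite lx addnA addnK.
Qed.

Lemma descendantS i z x :
  descendant i.+1 z x -> descendant i z (parent x) /\ descendant 1 (parent x) x.
Proof. by rewrite -addn1 => /descendant_split. Qed.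

Lemma adj_descendant x y : t x y -> descendant 1 x y \/ descendant 1 y x.
Proof.
move=> xy; have := level_adj xy; rewrite leq_eqVlt => /predU1P[lxy|].
  left; rewrite /descendant /= lxy addn1 eqxx andbT; apply/eqP/parentE => //.
  by rewrite adj_sym.
rewrite ltnS leq_eqVlt eq_sym (negbTE (level_adj_neq xy)) /= => lyx.
have := xy; rewrite adj_sym => /level_adj h.
right; rewrite /descendant /= addn1.
have lxy : level x = (level y).+1 by apply/eqP; rewrite eqn_leq h.
by rewrite lxy eqxx andbT; apply/eqP/parentE.
Qed.

(** Induction on the walk.  A first step upwards adds a generation on the side of
    [x]; a first step downwards is undone by the ascent that follows it or, if
    there is none, lengthens the descent to the other end. *)
Lemma path_confluent x s : path t x s ->
  exists z i j, [/\ i + j <= size s, descendant i z x & descendant j z (last x s)].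
Proof.
elim: s x => [x _|y s IH x /= /andP[xy ps]].
  by exists x, 0, 0; rewrite !descendant0 eqxx.
have [z [i [j [ij iy jl]]]] := IH _ ps.
have [xy1|yx1] := adj_descendant xy; last first.
  by exists z, i.+1, j; split => //; rewrite -add1n; exact: descendant_add yx1.
case: i => [|i] in ij iy *; last first.
  have [ix _] := descendantS iy; exists z, i, j; split => //.
    by rewrite addSn in ij; rewrite (leq_trans (ltnW ij)).
  by move: ix; have /= -> := descendant_iterE xy1.
move: iy; rewrite descendant0 => /eqP yz; rewrite yz in xy1.
exists x, 0, j.+1; split=> //; first by rewrite descendant0.
by rewrite -addn1; exact: descendant_add jl.
Qed.

Lemma gball_confluent r x y : gball t r x y ->
  exists z i j, [/\ i + j <= r, descendant i z x & descendant j z y].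
Proof.
move=> d; have [s [ps ls ss]] := gdistP x y; rewrite -ls.
have [z [i [j [ij ix jy]]]] := path_confluent ps; exists z, i, j; split => //.
by rewrite (leq_trans ij)// ss; exact: d.
Qed.

Lemma descendant_path i z x : descendant i z x ->
  exists s, [/\ path t z s, last z s = x & size s = i].
Proof.
elim: i x => [x|i IH x /descendantS[/IH[s [ps ls ss]]]].
  by rewrite descendant0 => /eqP ->; exists [::].
rewrite descendant1 => /andP[xo _]; have [xp _] := parentP xo.
exists (rcons s x); rewrite rcons_path last_rcons size_rcons ps ls ss.
by rewrite adj_sym xp.
Qed.

Lemma descendant_gball i z x : descendant i z x -> gball t i z x.
Proof. by case/descendant_path => s [ps <- <-]; exact: gdist_path. Qed.

Lemma descendant_branch i y z : t o y -> descendant i y z -> branch t o y z.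
Proof.
move=> oy yz; have [s [ps ls ss]] := descendant_path yz.
have ly : level y = 1.
  have := level_adj oy; have := level_adj_neq oy; rewrite level_root.
  by case: (level y) => [|[]].
exists s; split; last by rewrite -ls mem_last.
split => /=; first by rewrite oy.
by rewrite -/(level _) ls ss (descendant_level yz) ly.
Qed.

Lemma gball_symm r x y : gball t r x y -> gball t r y x.
Proof.
move=> d; have [s [ps ls ss]] := gdistP x y.
have d' : size s <= r by rewrite ss; exact: d.
apply: leq_trans d'; rewrite -(size_belast x) -size_rev.
have lx : last y (rev (belast x s)) = x.
  case: s {ss} ps ls => [|w s] ps ls //=; last by rewrite rev_cons last_rcons.
rewrite -[X in gdist t y X]lx; apply: gdist_path.
rewrite -ls rev_path (eq_path (e' := t))// => u v.
by rewrite /= adj_sym.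
Qed.

End rooted_tree.

(** * Finite sums over lists *)

Section elements.
Variable T : choiceType.

Definition elements (A : set T) : seq T := finmap.enum_fset (fset_set A).

Lemma elements_uniq A : uniq (elements A).
Proof. exact: finmap.fset_uniq. Qed.

Lemma mem_elements A x : finite_set A -> (x \in elements A) = `[< A x >].
Proof. by move=> fA; rewrite in_fset_set. Qed.

End elements.

Section finite_sums.
Local Open Scope ring_scope.
Variable R : realFieldType.

(** [f] recovers the index of the list in which an element was found, so the
    lists are pairwise disjoint. *)
Lemma uniq_flatten_fibers (S T : eqType) (F : T -> seq S) (f : S -> T) (s : seq T) :
  uniq s -> {in s, forall x, uniq (F x)} ->
  (forall x y, y \in F x -> f y = x) -> uniq (flatten [seq F x | x <- s]).
Proof.
move=> + + fF; elim: s => [//|x s IH] /= /andP[xs us] uF.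
rewrite cat_uniq uF ?mem_head//= IH//; last first.
  by move=> y ys; apply: uF; rewrite inE ys orbT.
rewrite andbT; apply/hasPn => y /flatten_mapP[z zs /fF yz].
by apply: contra xs => /fF <-; rewrite yz.
Qed.

Lemma ler_sum_subseq (T : eqType) (h : T -> R) (s u : seq T) :
  (forall x, 0 <= h x) -> uniq s -> {subset s <= u} ->
  \sum_(x <- s) h x <= \sum_(x <- u) h x.
Proof.
move=> h0; elim: s u => [|x s IH] u /=.
  by move=> _ _; rewrite big_nil sumr_ge0.
move=> /andP[xs us] su.
have xu : x \in u by rewrite su// mem_head.
rewrite big_cons (perm_big _ (perm_to_rem xu))/= big_cons lerD2l IH// => y ys.
have := su y; rewrite inE ys orbT => /(_ isT).
rewrite (perm_mem (perm_to_rem xu)) inE => /predU1P[yx|//].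
by rewrite -yx ys in xs.
Qed.

Lemma ler_sum_cover (S T : eqType) (h : T -> R) (B : seq T) (I : seq S)
    (P : pred S) (F : S -> seq T) :
  (forall x, 0 <= h x) -> uniq B ->
  {in B, forall y, exists c, [/\ c \in I, P c & y \in F c]} ->
  \sum_(y <- B) h y <= \sum_(c <- I | P c) \sum_(y <- F c) h y.
Proof.
move=> h0 uB BF.
have BF' : {subset B <= flatten [seq F c | c <- I & P c]}.
  move=> y /BF[c [cI Pc yc]]; apply/flatten_mapP; exists c => //.
  by rewrite mem_filter Pc.
apply: le_trans (ler_sum_subseq h0 uB BF') _.
by rewrite big_flatten big_map big_filter.
Qed.

Lemma size_sum1 (T : Type) (s : seq T) : (size s)%:R = \sum_(x <- s) 1 :> R.
Proof. by rewrite big_const_seq count_predT iter_addr_0. Qed.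

Lemma sum_geometric_le (q c : R) n : 0 <= q -> q < 1 -> 1 <= c * (1 - q) ->
  \sum_(i < n) q ^+ i <= c.
Proof.
move=> q0 q1 cq; have := subrX1 q n; set S := \sum_(i < n) _ => e.
have : 0 <= q ^+ n by exact: exprn_ge0.
by nra.
Qed.

Lemma sum_expr_le2 (K : R) n : 2 <= K -> \sum_(i < n.+1) K ^+ i <= 2 * K ^+ n.
Proof.
move=> K2; elim: n => [|n IH]; first by rewrite big_ord1 expr0; lra.
rewrite big_ord_recr/=; have Kn : 0 <= K ^+ n by rewrite exprn_ge0//; lra.
by rewrite exprS; nra.
Qed.

(** A geometric sum is comparable to its largest term, here less than [v]. *)
Lemma sum_expr_lt_le2 (K v : R) n : 2 <= K -> 0 <= v ->
  \sum_(i < n | K ^+ i < v) K ^+ i <= 2 * v.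
Proof.
move=> K2 v0; elim: n => [|n IH]; first by rewrite big_ord0 mulr_ge0.
have [Kv|vK] := ltP (K ^+ n) v; last first.
  by rewrite big_mkcond big_ord_recr/= -big_mkcond ltNge vK addr0.
apply: (@le_trans _ _ (\sum_(i < n.+1) K ^+ i)).
  rewrite [leRHS](bigID (fun i : 'I_n.+1 => K ^+ i < v)) /= lerDl sumr_ge0// => i _.
  by rewrite exprn_ge0//; lra.
by apply: le_trans (sum_expr_le2 n K2) _; lra.
Qed.

Lemma big_iota_ord n (F : nat -> R) :
  \sum_(i <- iota 0 n) F i = \sum_(i < n) F i.
Proof. by rewrite -{1}(subn0 n) -/(index_iota 0 n) big_mkord. Qed.

End finite_sums.


(** * Generations *)

Section generations.
Local Open Scope nat_scope.
Variables (V : choiceType) (t : tree V) (o : V).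
Hypothesis locally_finite : forall x, finite_set [set y | t x y].

Local Notation level := (level t o).
Local Notation parent := (parent t o).
Local Notation descendant := (descendant t o).

Definition children z := elements [set y | descendant 1 z y].

Lemma mem_children z y : (y \in children z) = descendant 1 z y.
Proof.
rewrite mem_elements ?asboolb//.
apply: sub_finite_set (locally_finite z) => y' /=; rewrite descendant1.
by move=> /andP[/(parentP t) [+ _] /eqP <-]; rewrite adj_sym.
Qed.

Lemma children_uniq z : uniq (children z).
Proof. exact: elements_uniq. Qed.

Fixpoint generation j z : seq V :=
  if j is j'.+1 then flatten [seq children y | y <- generation j' z] else [:: z].

Lemma mem_generation j z y : (y \in generation j z) = descendant j z y.
Proof.
elim: j y => [y|j IH y] /=; first by rewrite inE descendant0.
apply/flatten_mapP/idP => [[w]|].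
  by rewrite IH mem_children => zw wy; rewrite -add1n; exact: descendant_add wy.
by move=> /descendantS[zy yy]; exists (parent y); rewrite ?IH ?mem_children.
Qed.

Lemma generation_uniq j z : uniq (generation j z).
Proof.
elim: j => [//|j IH] /=; apply: (uniq_flatten_fibers (f := parent)) => //.
  by move=> x _; exact: children_uniq.
by move=> x y; rewrite mem_children => /descendant_iterE.
Qed.

(** The factor [Q z] encodes that vertices outside [Q] have no child in [Q], which
    keeps the induction inside [Q]. *)
Lemma size_generation_le (Q : pred V) k :
  (forall z, (size [seq y <- children z | Q y] <= Q z * k)%N) ->
  forall j z, (size [seq y <- generation j z | Q y] <= k ^ j)%N.
Proof.
move=> Qk; elim=> [|j IH] z /=; first by case: (Q z).
rewrite filter_flatten -map_comp size_flatten /shape -map_comp sumnE big_map.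
apply: (@leq_trans (\sum_(w <- generation j z) Q w * k)%N).
  by apply: leq_sum => w _; exact: Qk.
rewrite -big_distrl/= expnSr leq_mul2r; apply/orP; right.
apply: leq_trans (IH z); rewrite size_filter -sum1_count [leqRHS]big_mkcond/=.
by apply/eq_leq; apply: eq_bigr => w _; case: (Q w).
Qed.

Lemma size_generation_ge (Q : pred V) k :
  (forall z, Q z -> (k <= size (children z))%N) ->
  (forall z y, Q z -> descendant 1 z y -> Q y) ->
  forall j z, Q z -> (k ^ j <= size (generation j z))%N.
Proof.
move=> Qk Qd j z Qz.
suff [] : (k ^ j <= size (generation j z))%N /\ all Q (generation j z) by [].
elim: j => [/=|j [IH aQ]]; first by rewrite Qz.
split=> /=; last first.
  apply/allP => y /flatten_mapP[w /(allP aQ) Qw].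
  by rewrite mem_children; exact: Qd.
rewrite size_flatten /shape -map_comp sumnE big_map.
apply: (@leq_trans (\sum_(w <- generation j z) k)%N).
  by rewrite big_const_seq count_predT iter_addn_0 mulnC expnSr leq_mul2r IH orbT.
by rewrite big_seq [leqRHS]big_seq; apply: leq_sum => w /(allP aQ); exact: Qk.
Qed.

End generations.

(** * The weak type inequality from growth bounds on generations *)

Section weak_type_core.
Local Open Scope ring_scope.
Variables (R : realType) (V : choiceType) (t : tree V) (o : V).
Hypothesis locally_finite : forall x, finite_set [set y | t x y].

Local Notation level := (level t o).
Local Notation parent := (parent t o).
Local Notation generation := (generation t o).

Variable h : V -> R.
Hypothesis h0 : forall x, 0 <= h x.

(** Indexing by [s = i + j] and [j], rather than by [i] and [j], makes the bounds
    in [sum_gball_le] products of two geometric sums. *)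
Lemma gball_generation r x y : gball t r x y -> exists s j,
  [/\ (j <= s)%N, (s <= r)%N, (s - j <= level x)%N &
      y \in generation j (iter (s - j) parent x)].
Proof.
move=> /(gball_confluent o)[z [i [j [ij ix jy]]]]; exists (i + j)%N, j.
rewrite leq_addl ij addnK (descendant_iterE ix) mem_generation//.
by rewrite (descendant_level ix) leq_addl.
Qed.

(** With [s = i + j], the terms are at most [mu * K ^ s * (2 / 3) ^ j]; the sum
    over [j] costs a factor 3, the sum over [s <= r] a factor 2 and [K ^ r]. *)
Lemma sum_gball_le (K mu : R) r x (B : seq V) : 2 <= K -> 0 <= mu -> uniq B ->
  {in B, forall y, gball t r x y} ->
  (forall i j, (i + j <= r)%N -> (i <= level x)%N ->
    \sum_(y <- generation j (iter i parent x)) h y <=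
      mu * K ^+ i * (2 / 3 * K) ^+ j) ->
  \sum_(y <- B) h y <= 6 * mu * K ^+ r.
Proof.
move=> K2 mu0 uB Bx gx; have K0 : 0 <= K by lra.
pose I := [seq (s, j) | s <- iota 0 r.+1, j <- iota 0 s.+1].
pose P (c : nat * nat) := (c.1 - c.2 <= level x)%N.
pose F (c : nat * nat) := generation c.2 (iter (c.1 - c.2) parent x).
apply: (@le_trans _ _ (\sum_(c <- I | P c) \sum_(y <- F c) h y)).
  apply: ler_sum_cover => // y /Bx /gball_generation[s [j [js sr sx yF]]].
  exists (s, j); split => //; apply/allpairsPdep; exists s, j.
  by rewrite !mem_iota !add0n !ltnS.
apply: (@le_trans _ _ (\sum_(c <- I) mu * (K ^+ c.1 * (2 / 3) ^+ c.2))).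
  rewrite big_mkcond big_seq [leRHS]big_seq; apply: ler_sum => -[s j].
  move=> /allpairsPdep[s0 [j0 [+ + [-> ->]]]] {s j}.
  move: s0 j0 => s j; rewrite !mem_iota !add0n !ltnS /P /F /= => sr js.
  case: ifPn => [sx|_]; last by rewrite !mulr_ge0// exprn_ge0//; lra.
  apply: le_trans (gx _ _ _ sx) _; first by rewrite subnK.
  rewrite exprMn_comm; last exact: mulrC.
  rewrite -[in leRHS](subnK js) exprD; lra.
rewrite -mulr_sumr big_allpairs_dep.
have -> : 6 * mu * K ^+ r = mu * (3 * (2 * K ^+ r)) by ring.
apply: ler_wpM2l => //.
apply: (@le_trans _ _ (\sum_(s <- iota 0 r.+1) 3 * K ^+ s)).
  apply: ler_sum => s _; rewrite -mulr_sumr mulrC big_iota_ord; apply: ler_wpM2r.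
    exact: exprn_ge0.
  by apply: sum_geometric_le; lra.
rewrite -mulr_sumr; apply: ler_wpM2l => //.
rewrite big_iota_ord.
exact: sum_expr_le2.
Qed.

(** A large mean around [x] forces, by [sum_gball_le], a large sum over a
    generation [j] below some ancestor [z] of [x]; the points [x] are then counted
    through the triples formed by [z], [j] and the height [i] of [z] above [x].
    Only the points [x] are confined to [Q]; the function [h] lives on the whole
    tree. *)
Lemma weak_type_core (Q : pred V) (k : nat) (lam N : R) (X : seq V)
    (r : V -> nat) (B : V -> seq V) :
  (2 <= k)%N -> 0 < lam ->
  (forall j z, (size [seq y <- generation j z | Q y] <= k ^ j)%N) ->
  (forall s, uniq s -> \sum_(y <- s) h y <= N) ->
  uniq X -> all Q X ->
  {in X, forall x, uniq (B x) /\ {in B x, forall y, gball t (r x) x y}} ->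
  {in X, forall x, lam * k%:R ^+ r x < \sum_(y <- B x) h y} ->
  lam * (size X)%:R <= 48 * N.
Proof.
move=> k2 lam0 Qk hN uX QX BX hX.
pose K : R := k%:R; have K2 : 2 <= K by rewrite ler_nat.
pose g j z := \sum_(y <- generation j z) h y.
have g0 j z : 0 <= g j z by exact: sumr_ge0.
pose n := (\max_(x <- X) r x).+1.
(* [K ^ i < c j * g j z] says that [g j z] exceeds the bound of [sum_gball_le]
   for [mu = lam / 6], the value for which that lemma yields [lam * K ^ r]. *)
pose c j : R := 6 / lam * (3 / (2 * K)) ^+ j.
have c0 j : 0 <= c j.
  by rewrite mulr_ge0 ?exprn_ge0 ?divr_ge0//; lra.
pose Z := undup [seq iter i parent x | x <- X, i <- iota 0 n].
pose I := [seq (z, ji) | z <- Z, ji <- [seq (j, i) | j <- iota 0 n, i <- iota 0 n]].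
pose P (d : V * (nat * nat)) := K ^+ d.2.2 < c d.2.1 * g d.2.1 d.1.
pose F (d : V * (nat * nat)) := [seq y <- generation d.2.2 d.1 | Q y].
have cover : {in X, forall x, exists d, [/\ d \in I, P d & x \in F d]}.
  move=> x xX; apply: contrapT => noc.
  have [uB Bx] := BX _ xX; have := hX _ xX; apply/negP; rewrite -leNgt.
  have -> : lam * K ^+ r x = 6 * (lam / 6) * K ^+ r x by congr *%R; field.
  apply: (@sum_gball_le _ _ (r x) x) => //; first by rewrite divr_ge0// ltW.
  move=> i j ijr ix.
  rewrite leNgt; apply/negP => gij; apply: noc.
  exists (iter i parent x, (j, i)).
  have rn : (r x < n)%N by rewrite ltnS (@leq_bigmax_seq _ _ xpredT r x).
  have im : (i < n)%N by rewrite (leq_ltn_trans _ rn)// (leq_trans _ ijr)// leq_addr.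
  have jm : (j < n)%N by rewrite (leq_ltn_trans _ rn)// (leq_trans _ ijr)// leq_addl.
  split.
  - apply/allpairsPdep; exists (iter i parent x), (j, i); split => //.
      rewrite mem_undup; apply/allpairsPdep; exists x, i.
      by rewrite mem_iota.
    by apply/allpairsPdep; exists j, i; rewrite !mem_iota.
  - rewrite /P /= -/(g _ _) in gij *.
    have -> : K ^+ i = c j * (lam / 6 * K ^+ i * (2 / 3 * K) ^+ j).
      rewrite /c !exprMn exprVn exprMn.
      have Kj : K ^+ j != 0 by rewrite expf_neq0//; apply/eqP; lra.
      have tj : 3 ^+ j != 0 :> R by rewrite expf_neq0.
      have twj : 2 ^+ j != 0 :> R by rewrite expf_neq0.
      rewrite exprVn; field; rewrite Kj tj twj /=.
      by apply/eqP; lra.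
    rewrite ltr_pM2l// /c mulr_gt0 ?exprn_gt0 ?divr_gt0//; lra.
  - rewrite /F mem_filter (allP QX)//= mem_generation//.
    exact: descendant_iter.
have : (size X)%:R <= \sum_(d <- I | P d) \sum_(y <- F d) (1 : R).
  by rewrite size_sum1; exact: ler_sum_cover.
rewrite (eq_bigr (fun d => (size (F d))%:R)); last first.
  by move=> d _; rewrite size_sum1.
move=> sX; suff : (size X)%:R <= 48 * N / lam.
  by rewrite ler_pdivlMr// mulrC.
apply: (le_trans sX).
apply: (@le_trans _ _ (\sum_(d <- I | P d) K ^+ d.2.2)).
  by apply: ler_sum => d _; rewrite /K -natrX ler_nat; exact: Qk.
rewrite big_mkcond big_allpairs.
apply: (@le_trans _ _ (\sum_(z <- Z) \sum_(j < n) 2 * (c j * g j z))).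
  apply: ler_sum => z _; rewrite big_allpairs.
  rewrite big_iota_ord.
  apply: ler_sum => j _.
  rewrite big_iota_ord -big_mkcond /=.
  by rewrite /P; apply: (@sum_expr_lt_le2 R K (c j * g j z) n) => //; exact: mulr_ge0.
rewrite exchange_big/=.
apply: (@le_trans _ _ (\sum_(j < n) 2 * c j * N)).
  apply: ler_sum => j _.
  under eq_bigr do rewrite mulrA.
  rewrite -mulr_sumr; apply: ler_wpM2l; first by rewrite mulr_ge0.
  rewrite /g -(big_map (generation j) xpredT (fun s => \sum_(y <- s) h y)).
  rewrite -big_flatten; apply: hN.
  apply: (uniq_flatten_fibers (f := iter j parent)).
  - exact: undup_uniq.
  - by move=> z _; exact: generation_uniq.
  - by move=> z y; rewrite mem_generation// => /descendant_iterE.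
rewrite -mulr_suml; have N0 : 0 <= N by have := hN [::] isT; rewrite big_nil.
have -> : 48 * N / lam = 2 * (6 / lam * 4) * N by field; lra.
apply: ler_wpM2r => //; rewrite -mulr_sumr; apply: ler_wpM2l => //.
rewrite -mulr_sumr; apply: ler_wpM2l; first by rewrite divr_ge0// ltW.
apply: (@le_trans _ _ (\sum_(j < n) (3 / 4) ^+ j)).
  apply: ler_sum => j _; apply: lerXn2r; rewrite ?nnegrE ?divr_ge0//; first lra.
  by rewrite ler_pdivrMr; lra.
by apply: sum_geometric_le; lra.
Qed.

End weak_type_core.

(** * From weak type to strong type, by dyadic levels *)

Section dyadic_interpolation.
Local Open Scope ring_scope.
Variable R : realType.

(** Dropping the terms above [v] leaves a geometric series of ratio [2 `^ (- s)]
    whose first term is at most [v `^ s]. *)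
Lemma sum_dyadic_powR_le (s v M : R) n : 0 < s -> 0 <= v -> 0 < M ->
  \sum_(k < n | M / 2 ^+ k <= v) (M / 2 ^+ k) `^ s <= (1 - 2 `^ (- s))^-1 * v `^ s.
Proof.
move=> s0 v0; set D := (_)^-1.
have s1 : 2 `^ (- s) < 1 :> R.
  rewrite powRN invf_lt1 ?powR_gt0//.
  have := gt0_ltr_powR s0 (x := 1) (y := 2); rewrite !nnegrE powR1; apply => //.
  by rewrite ltr1n.
have D0 : 0 <= D by rewrite invr_ge0 subr_ge0 ltW.
elim: n v M v0 => [|n IH] v M v0 M0.
  by rewrite big_ord0 mulr_ge0 ?powR_ge0.
have half k : M / 2 ^+ k.+1 = M / 2 / 2 ^+ k by rewrite exprS invfM mulrA.
have M20 : 0 < M / 2 by rewrite divr_gt0.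
rewrite big_mkcond big_ord_recl /= expr0 divr1.
under eq_bigr do rewrite /bump /= add1n half.
rewrite -big_mkcond; case: ifPn => [Mv|_]; last by rewrite add0r IH.
apply: (@le_trans _ _ (M `^ s + D * (M / 2) `^ s)).
  rewrite lerD2l (le_trans _ (IH _ _ (ltW M20) M20))//.
  rewrite [leRHS]big_mkcond [leLHS]big_mkcond /=; apply: ler_sum => k _.
  have -> : M / 2 / 2 ^+ k <= M / 2.
    by rewrite ler_pdivrMr ?exprn_gt0// (ler_peMr (ltW M20))// exprn_ege1// ler1n.
  by case: ifPn => // _; exact: powR_ge0.
have -> : (M / 2) `^ s = M `^ s * 2 `^ (- s).
  by rewrite powRM ?ltW// -[2^-1]powR_inv1// -powRrM mulN1r.
have -> : M `^ s + D * (M `^ s * 2 `^ (- s)) = D * M `^ s.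
  rewrite /D; field; rewrite subr_eq0; apply/eqP => e.
  by move: s1; rewrite -e ltxx.
apply: ler_wpM2l => //; apply: ge0_ler_powR; rewrite ?nnegrE //; exact: ltW.
Qed.

(** A single term suffices: the one with [u <= M / 2 ^ k < 2 * u]. *)
Lemma dyadic_powR_le (s u M : R) : 0 < s -> 0 <= u <= M -> 0 < M -> exists n0,
  forall n, (n0 <= n)%N -> 
  u `^ s <= \sum_(k < n | M / 2 ^+ k < 2 * u) (M / 2 ^+ k) `^ s.
Proof.
move=> s0 /andP[]; rewrite le_eqVlt => /predU1P[<- _ _|u0 uM M0].
  exists 0%N => n _; rewrite powR0 ?gt_eqF// sumr_ge0// => k _.
  exact: powR_ge0.
have ex : exists m, M / 2 ^+ m < u.
  exists (Num.truncn (M / u)).+1; rewrite ltr_pdivrMr ?exprn_gt0//.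
  rewrite mulrC -ltr_pdivrMr// (lt_le_trans (truncnS_gt _))//.
  by rewrite -natrX ler_nat ltnW// ltn_expl.
case: (ex_minnP ex) => -[|m] mu mmin.
  by move: mu; rewrite expr0 divr1 ltNge uM.
exists m.+1 => n mn; rewrite (bigD1 (Ordinal mn))/=; last first.
  move: mu; rewrite exprS invfM mulrA ltr_pdivrMr ?exprn_gt0//.
  by rewrite !ltr_pdivrMr// mulrAC ?ltr_pdivrMr ?exprn_gt0//; lra.
rewrite -[leLHS]addr0 lerD//; last by apply: sumr_ge0 => k _; exact: powR_ge0.
apply: ge0_ler_powR; rewrite ?nnegrE; [exact: ltW..| |].
  by rewrite ltW// divr_gt0// exprn_gt0.
by rewrite leNgt; apply/negP => /mmin; rewrite ltnn.
Qed.

(** The hypothesis is what a weak type [(1, 1)] inequality gives when [f] is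
    truncated at height [lam / 2], the small part of [f] contributing at most
    [lam / 2] to [u].  Summing it over the dyadic values of [lam] with weights
    [lam `^ p] leaves, for each [y], a geometric series with exponent
    [p - 1 > 0], whose terms are all below [4 * f y]. *)
Lemma dyadic_interpolation (S T : eqType) (X : seq S) (Y : seq T) (u : S -> R)
    (f : T -> R) (p C : R) : 1 < p -> 0 <= C ->
  (forall x, 0 <= u x) -> (forall y, 0 <= f y) ->
  (forall lam, 0 < lam -> lam * (size [seq x <- X | lam < u x])%:R <=
     C * \sum_(y <- Y | lam / 2 < f y) f y) ->
  \sum_(x <- X) u x `^ p <=
  C * (2 * 4 `^ (p - 1) * (1 - 2 `^ (1 - p))^-1) * \sum_(y <- Y) f y `^ p.
Proof.
move=> p1 C0 u0 f0 weak.
have p10 : 0 < p - 1 by rewrite subr_gt0.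
have p0 : 0 < p by rewrite (lt_trans _ p1).
(* The grid [M / 2 ^ k] starts at any positive upper bound of [u] on [X]. *)
pose M := 1 + \sum_(x <- X) u x.
have M0 : 0 < M by rewrite ltr_wpDr// sumr_ge0.
have uM : {in X, forall x, u x <= M}.
  move=> x xX; rewrite /M (perm_big _ (perm_to_rem xX))/= big_cons.
  have : 0 <= \sum_(y <- rem x X) u y by exact: sumr_ge0.
  by lra.
pose q k : R := M / 2 ^+ k.
have q0 k : 0 < q k by rewrite divr_gt0// exprn_gt0.
have [n un] : exists n, {in X, forall x,
    u x `^ p <= \sum_(k < n | q k < 2 * u x) q k `^ p}.
  have /choice[F FP] : forall x, exists n0, x \in X -> forall n, (n0 <= n)%N ->
      u x `^ p <= \sum_(k < n | q k < 2 * u x) q k `^ p.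
    move=> x; case: (boolP (x \in X)) => xX; last by exists 0%N.
    have [|n0 n0P] := @dyadic_powR_le p (u x) M p0 _ M0.
      by rewrite u0 uM.
    by exists n0 => _.
  exists (\max_(x <- X) F x)%N => x xX; apply: FP => //.
  exact: (@leq_bigmax_seq _ _ xpredT F x).
apply: (@le_trans _ _ (\sum_(x <- X) \sum_(k < n | q k < 2 * u x) q k `^ p)).
  by rewrite big_seq [leRHS]big_seq; apply: ler_sum.
apply: (@le_trans _ _ (\sum_(k < n) \sum_(y <- Y | q k <= 4 * f y)
    2 * C * f y * q k `^ (p - 1))).
  rewrite (exchange_big_dep xpredT)//=; apply: ler_sum => k _.
  have -> : \sum_(x <- X | q k < 2 * u x) q k `^ p =
      2 * q k `^ (p - 1) * (q k / 2 * (size [seq x <- X | q k / 2 < u x])%:R).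
    rewrite -(mulr_powRB1 (ltW (q0 k)) p0) size_filter -sum1_count natr_sum.
    rewrite !mulr_sumr; apply: eq_big => [x|x _]; last by field.
    by have := q0 k; set qk := q k => _; apply/idP/idP => ?; lra.
  rewrite -mulr_suml -mulr_sumr.
  rewrite [leRHS](_ : _ = 2 * q k `^ (p - 1) *
    (C * \sum_(y <- Y | q k <= 4 * f y) f y)); last by ring.
  apply: ler_wpM2l; first by rewrite mulr_ge0 ?powR_ge0.
  apply: le_trans (weak _ _) _; first by rewrite divr_gt0.
  apply: ler_wpM2l => //; rewrite [leLHS]big_mkcond [leRHS]big_mkcond /=.
  apply: ler_sum => y _; have fy := f0 y; have qk := q0 k.
  by have [h1|h1] := ltP (q k / 2 / 2) (f y); have [h2|h2] := leP (q k) (4 * f y);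
    lra.
rewrite (exchange_big_dep xpredT)//= mulr_sumr; apply: ler_sum => y _.
rewrite -mulr_sumr.
apply: (@le_trans _ _ (2 * C * f y * ((1 - 2 `^ (- (p - 1)))^-1 * (4 * f y) `^ (p - 1)))).
  apply: ler_wpM2l; first by rewrite !mulr_ge0.
  by apply: sum_dyadic_powR_le => //; rewrite mulr_ge0.
rewrite powRM// opprB -(mulr_powRB1 (f0 y) p0) le_eqVlt; apply/orP; left.
by apply/eqP; ring.
Qed.

End dyadic_interpolation.

(** * The tree F_{a,b} *)

Section balls.
Local Open Scope nat_scope.
Variables (V : choiceType) (t : tree V).
Hypothesis locally_finite : forall x, finite_set [set y | t x y].

Lemma gball_trans r s x y z : gball t r x y -> gball t s y z -> gball t (r + s) x z.
Proof.
move=> xy yz; have [p [pp lp sp]] := gdistP t x y.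
have [q [pq lq sq]] := gdistP t y z.
have := @gdist_path _ t x (p ++ q); rewrite cat_path last_cat lp lq pp pq size_cat.
by move=> /(_ isT) h; apply: leq_trans h _; rewrite sp sq leq_add.
Qed.

Lemma gballxx r x : gball t r x x.
Proof.
have := @gdist_path _ t x [::] isT; rewrite /= leqn0 => /eqP e.
by rewrite /gball /= e.
Qed.

Lemma finite_gball r x : finite_set (gball t r x).
Proof.
apply: (@sub_finite_set _ _
  [set` flatten [seq generation t x j x | j <- iota 0 r.+1]]);
  last exact: finite_seq.
move=> y xy; apply/flatten_mapP.
have lxy : level t x y <= r := xy.
exists (level t x y); first by rewrite mem_iota.
rewrite mem_generation// /descendant level_root add0n eqxx andbT.
have := @level_iter_parent _ t x _ y (leqnn _); rewrite subnn => /eqP.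
by rewrite level_eq0.
Qed.

Lemma mem_gball r x y : (y \in elements (gball t r x)) <-> gball t r x y.
Proof. by rewrite mem_elements; [split => /asboolP | exact: finite_gball]. Qed.

End balls.

Section Fab.
Local Open Scope nat_scope.
Variables (a b : nat) (V : choiceType) (t : tree V) (o : V) (g : 'I_a.+1 -> V).
Hypotheses (ha : 2 <= a) (hab : a < b) (ht : is_Fab t a b o g).

Local Notation level := (level t o).
Local Notation parent := (parent t o).
Local Notation descendant := (descendant t o).

(** The branch through [g ord0], described by the ancestor of level 1. *)
Definition b_side y := (0 < level y) && (iter (level y).-1 parent y == g ord0).

Lemma adj_root y : t o y <-> exists j, y = g j.
Proof.
case: ht => _ + _ _ => /seteqP[og go]; split => [/og[j _ <-]|[j ->]].
  by exists j.
exact: go.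
Qed.

Lemma level_g j : level (g j) = 1.
Proof.
have og : t o (g j) by apply/adj_root; exists j.
have := level_adj o og; have := level_adj_neq o og; rewrite level_root.
by case: (level _) => [|[]].
Qed.

Lemma descendant_g y : y != o ->
  exists j, descendant (level y).-1 (g j) y.
Proof.
rewrite -(level_eq0 t) -lt0n => y0.
have := @descendant_iter _ t o (level y).-1 y (leq_pred _).
set w := iter _ _ _ => dw.
have lw : level w = 1.
  rewrite /w level_iter_parent ?leq_pred//; case: (level y) y0 => // n _.
  by rewrite subSnn.
have wo : w != o by rewrite -(level_eq0 t) lw.
have [wp lpw] := parentP t wo.
move: lpw; rewrite lw => -[/esym/eqP]; rewrite level_eq0 => /eqP po.
have /adj_root[j wg] : t o w by rewrite adj_sym -po.
by exists j; rewrite -wg.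
Qed.

Lemma b_side_g0 : b_side (g ord0).
Proof. by rewrite /b_side level_g /= eqxx. Qed.

Lemma b_side_root : b_side o = false.
Proof. by rewrite /b_side level_root. Qed.

Lemma b_side_generation y : b_side y -> descendant (level y).-1 (g ord0) y.
Proof.
move=> /andP[y0 /eqP e]; rewrite -e; apply: descendant_iter; exact: leq_pred.
Qed.

(** Below a vertex other than the root, the ancestor of level 1 does not change. *)
Lemma b_side_descendant i z y : z != o -> descendant i z y -> b_side y = b_side z.
Proof.
rewrite -(level_eq0 t) -lt0n => z0 zy.
rewrite /b_side (descendant_level zy) addn_gt0 z0/=.
case: (level z) z0 => // n _ /=; rewrite iterD.
by rewrite (descendant_iterE zy).
Qed.

Lemma Fab_valence y : y != o -> has_valence t y (if b_side y then b.+1 else a.+1).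
Proof.
move=> yo; have [j gy] := descendant_g yo; case: ht => gI _ vb va.
have gjo : g j != o by rewrite -(level_eq0 t) level_g.
have ogj : t o (g j) by apply/adj_root; exists j.
have := descendant_branch ogj gy.
rewrite (b_side_descendant gjo gy) /b_side level_g /= (inj_eq gI).
by case: eqP => [->|/eqP j0]; [exact: vb | exact: va].
Qed.

Lemma Fab_locally_finite x : finite_set [set y | t x y].
Proof.
have [->|xo] := eqVneq x o; last first.
  by apply/finite_setP; eexists; exact: Fab_valence.
case: ht => _ -> _ _; exact: finite_image.
Qed.

Local Notation lf := Fab_locally_finite.
Local Notation children := (children t o).
Local Notation generation := (generation t o).

Lemma size_children_nonroot z : z != o -> size (children z) = if b_side z then b else a.
Proof.
move=> zo; have := card_fset_set (Fab_valence zo).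
have [zp lz] := parentP t zo.
suff /perm_size <- : perm_eq (parent z :: children z) (elements [set y | t z y]).
  by case: ifP => _ /= [].
apply: uniq_perm; rewrite ?elements_uniq//=.
  rewrite children_uniq andbT (mem_children o lf); apply/negP => /descendant_level.
  by rewrite lz; lia.
move=> y; rewrite inE (mem_children o lf) (mem_elements _ (lf z)).
apply/orP/asboolP => [[/eqP ->//|]|zy].
  rewrite descendant1 => /andP[yo /eqP py].
  by have [] := parentP t yo; rewrite py adj_sym.
have [->|] := adj_descendant o zy; first by right.
by rewrite descendant1 => /andP[_ /eqP ->]; left.
Qed.

Lemma mem_children_root y : (y \in children o) = (y \in [seq g j | j <- enum 'I_a.+1]).
Proof.
rewrite (mem_children o lf) descendant1.
apply/andP/mapP => [[yo /eqP py]|[j _ ->]].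
  have [yp _] := parentP t yo; rewrite py adj_sym in yp.
  by have /adj_root[j ->] := yp; exists j; rewrite ?mem_enum.
rewrite -(level_eq0 t) level_g; split=> //; apply/eqP/parentE.
  by rewrite adj_sym; apply/adj_root; exists j.
by rewrite level_g level_root.
Qed.

Lemma g_inj : injective g. Proof. by case: ht. Qed.

Lemma size_children_root : size (children o) = a.+1.
Proof.
rewrite (perm_size (_ : perm_eq _ [seq g j | j <- enum 'I_a.+1])).
  by rewrite size_map size_enum_ord.
apply: uniq_perm.
- exact: children_uniq.
- by rewrite map_inj_uniq ?enum_uniq//; exact: g_inj.
- exact: mem_children_root.
Qed.

Lemma size_generation_le_b j z : size (generation j z) <= b ^ j.
Proof.
rewrite -[generation j z]filter_predT; apply: size_generation_le => {}z.
rewrite filter_predT mul1n; have [->|zo] := eqVneq z o.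
  by rewrite size_children_root.
by rewrite size_children_nonroot//; case: ifP => // _; exact: ltnW.
Qed.

(** The root has [a + 1] children, but only [a] of them are outside the branch. *)
Lemma size_generation_le_a j z :
  size [seq y <- generation j z | ~~ b_side y] <= a ^ j.
Proof.
apply: (size_generation_le (Q := predC b_side)) => {}z.
have [->|zo] := eqVneq z o.
  rewrite /= b_side_root mul1n -ltnS -size_children_root.
  rewrite size_filter -(count_predC b_side (children o)) addnC -addn1 leq_add2l.
  rewrite -has_count; apply/hasP; exists (g ord0); last exact: b_side_g0.
  by rewrite mem_children_root map_f// mem_enum.
have cz y : y \in children z -> b_side y = b_side z.
  by rewrite (mem_children o lf); exact: b_side_descendant.
rewrite /=; case: (boolP (b_side z)) => zb; last first.
  rewrite mul1n size_filter (leq_trans (count_size _ _))//.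
  by rewrite size_children_nonroot// (negbTE zb).
rewrite (eq_in_filter (a2 := pred0)) ?filter_pred0// => y yz.
by rewrite /= cz// zb.
Qed.

Lemma size_generation_ge_a j z : a ^ j <= size (generation j z).
Proof.
apply: (size_generation_ge lf (Q := predT)) => // {}z _.
have [->|zo] := eqVneq z o; first by rewrite size_children_root.
by rewrite size_children_nonroot//; case: ifP => // _; exact: ltnW.
Qed.

Lemma size_generation_ge_b j z : b_side z -> b ^ j <= size (generation j z).
Proof.
have bo y : b_side y -> y != o by apply: contraTneq => ->; rewrite b_side_root.
apply: (size_generation_ge lf (Q := b_side)) => {}z => [zb|y zb].
  by rewrite size_children_nonroot ?bo// zb.
by move/(b_side_descendant (bo _ zb)) => ->.
Qed.

Lemma generation_gball j z : {subset generation j z <= elements (gball t j z)}.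
Proof.
move=> y; rewrite (mem_generation o lf).
by move/descendant_gball => zy; apply/mem_gball => //; exact: lf.
Qed.

Lemma size_gball_ge_a r x : a ^ r <= size (elements (gball t r x)).
Proof.
apply: leq_trans (size_generation_ge_a r x) _; apply: uniq_leq_size.
  by apply: generation_uniq; exact: lf.
exact: generation_gball.
Qed.

Lemma size_gball_ge_b r x : b_side x -> b ^ r <= size (elements (gball t r x)).
Proof.
move=> xb; apply: leq_trans (size_generation_ge_b r xb) _; apply: uniq_leq_size.
  by apply: generation_uniq; exact: lf.
exact: generation_gball.
Qed.

Local Open Scope ring_scope.

(** The constant is [48] for each of the two parts of [X]. *)
Lemma Fab_weak_type (R : realType) (h : V -> R) (lam N : R) (X : seq V)
    (r : V -> nat) : (forall x, 0 <= h x) -> 0 < lam ->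
  (forall s, uniq s -> \sum_(y <- s) h y <= N) -> uniq X ->
  {in X, forall x, lam * (size (elements (gball t (r x) x)))%:R
                   < \sum_(y <- elements (gball t (r x) x)) h y} ->
  lam * (size X)%:R <= 96 * N.
Proof.
move=> h0 lam0 hN uX hX.
pose B x := elements (gball t (r x) x).
have BP x : uniq (B x) /\ {in B x, forall y, gball t (r x) x y}.
  by split=> [|y /mem_gball]; [exact: elements_uniq | apply; exact: lf].
have ltX (k : nat) x : x \in X -> (k ^ r x <= size (B x))%N ->
    lam * k%:R ^+ r x < \sum_(y <- B x) h y.
  move=> xX kB; apply: le_lt_trans (hX x xX); rewrite ler_pM2l//.
  by rewrite -natrX ler_nat.
have Xb : lam * (size [seq x <- X | b_side x])%:R <= 48 * N.
  apply: (@weak_type_core _ _ t o lf h h0 predT b lam N _ r B) => //.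
  - by rewrite (leq_trans ha)// ltnW.
  - by move=> j z; rewrite filter_predT; exact: size_generation_le_b.
  - exact: filter_uniq.
  - exact: all_predT.
  - move=> x; rewrite mem_filter => /andP[xb xX]; apply: ltX => //.
    exact: size_gball_ge_b.
have Xa : lam * (size [seq x <- X | predC b_side x])%:R <= 48 * N.
  apply: (@weak_type_core _ _ t o lf h h0 (predC b_side) a lam N _ r B) => //.
  - exact: size_generation_le_a.
  - exact: filter_uniq.
  - exact: filter_all.
  - move=> x; rewrite mem_filter => /andP[xb xX]; apply: ltX => //.
    exact: size_gball_ge_a.
rewrite -(count_predC b_side X) -!size_filter natrD; lra.
Qed.

End Fab.

(** * Finite forms of the maximal estimates *)

(** The Bernoulli inequality for [(1 + 1 / a) ^ k], cleared of denominators. *)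
Lemma exists_expn_gap (a b m : nat) :
  (0 < a -> a < b -> exists k, a ^ (m + k) <= b ^ k)%N.
Proof.
move=> a0 ab.
have bernoulli k : ((a + k) * a ^ k <= a * b ^ k)%N.
  elim: k => [|k IH]; first by rewrite addn0 !expn0.
  have : (a * b ^ k * a.+1 <= a * b ^ k * b)%N by rewrite leq_mul2l ab orbT.
  rewrite (expnSr b) mulnA; apply: leq_trans.
  apply: (@leq_trans ((a + k) * a ^ k * a.+1)%N); last by rewrite leq_mul2r IH orbT.
  by rewrite (expnSr a); nia.
exists (a ^ m.+1)%N; set k := (a ^ m.+1)%N.
rewrite -(leq_pmul2l a0); apply: leq_trans (bernoulli k).
by rewrite -expnS -addSn expnD -/k leq_mul2r leq_addl orbT.
Qed.

Section Fab_maximal.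
Local Open Scope nat_scope.
Variables (a b : nat) (V : choiceType) (t : tree V) (o : V) (g : 'I_a.+1 -> V).
Hypotheses (ha : 2 <= a) (hab : a < b) (ht : is_Fab t a b o g).

Local Notation level := (level t o).
Local Notation parent := (parent t o).
Local Notation descendant := (descendant t o).
Local Notation generation := (generation t o).
Local Notation lf := (Fab_locally_finite ht).
Local Notation b_side := (b_side t o g).
Local Notation ball r x := (elements (gball t r x)).

(** A geodesic between the branch and its complement passes through the root. *)
Lemma gball_b_side r z y : ~~ b_side z -> b_side y -> gball t r z y ->
  level z + level y <= r.
Proof.
move=> zb yb /(gball_confluent o)[w [i [j [ijr wz wy]]]].
have [wo|wo] := eqVneq w o; last first.
  by move: zb; rewrite (b_side_descendant g wo wz) -(b_side_descendant g wo wy) yb.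
move: wz wy => /descendant_level -> /descendant_level ->.
by rewrite wo level_root !add0n.
Qed.

(** Outside the branch the generations around [z] grow like powers of [a]; inside
    it only the first [k] generations below [g ord0] can be reached. *)
Lemma size_gball_le r z k : ~~ b_side z -> r <= level z + k.+1 ->
  size (ball r z) <= 4 * a ^ r + 2 * b ^ k.
Proof.
move=> zb rk.
rewrite -(@ler_nat rat) natrD !natrM !natrX -(count_predC (predC b_side)).
have geo (c : nat) n : 2 <= c -> (\sum_(i < n.+1) (c%:R : rat) ^+ i <= 2 * c%:R ^+ n)%R.
  by move=> c2; apply: sum_expr_le2; rewrite ler_nat.
rewrite -!size_filter natrD; apply: lerD.
  pose I := [seq (s, j) | s <- iota 0 r.+1, j <- iota 0 s.+1].
  pose F (c : nat * nat) :=
    [seq y <- generation c.2 (iter (c.1 - c.2) parent z) | ~~ b_side y].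
  rewrite size_sum1.
  apply: (@le_trans _ _ (\sum_(c <- I) \sum_(y <- F c) 1)%R).
    apply: ler_sum_cover => //; first by rewrite filter_uniq ?elements_uniq.
    move=> y; rewrite mem_filter => /andP[yb /(mem_gball lf)].
    move=> /(gball_generation o lf)[s [j [js sr sz yF]]].
    exists (s, j); split => //; last by rewrite mem_filter yF andbT.
    by apply/allpairsPdep; exists s, j; rewrite !mem_iota !add0n !ltnS.
  rewrite big_allpairs_dep.
  apply: (@le_trans _ _ (\sum_(s <- iota 0 r.+1) 2 * a%:R ^+ s)%R).
    apply: ler_sum => s _; rewrite big_iota_ord; apply: le_trans (geo _ _ ha).
    apply: ler_sum => j _; rewrite -size_sum1 -natrX ler_nat.
    exact: (size_generation_le_a ha hab ht).
  have := geo a r ha; rewrite -mulr_sumr big_iota_ord; lra.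
rewrite size_sum1.
apply: (@le_trans _ _ (\sum_(j <- iota 0 k.+1) \sum_(y <- generation j (g ord0)) 1)%R).
  apply: ler_sum_cover => //; first by rewrite filter_uniq ?elements_uniq.
  move=> y; rewrite mem_filter => /andP[/negPn yb /(mem_gball lf)] zy.
  have := gball_b_side zb yb zy => zyr.
  exists (level y).-1; rewrite mem_iota mem_generation; last exact: lf.
  split => //; last exact: b_side_generation.
  by have : 0 < level y by [case/andP: yb]; lia.
rewrite big_iota_ord; apply: le_trans (geo b k _); last first.
  by rewrite ltnW// (leq_trans _ hab).
apply: ler_sum => j _; rewrite -size_sum1 -natrX ler_nat.
exact: (size_generation_le_b ha hab ht).
Qed.

(** [E] is the generation [k] below [g ord0], and [F] the generation [r + m] below
    another neighbour of the root, [r = m + k + 2] being the radius of the balls;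
    the centre of the ball for a point of [F] is its ancestor [r] generations
    above.  Minimality of [k] keeps [b ^ k] comparable to [a ^ r], so that [F]
    outgrows [E] by a factor [a ^ m]. *)
Lemma uncentred_witness m : exists E F : seq V,
  [/\ uniq E, uniq F, 0 < size E, m * size E <= b * size F &
    forall x, x \in F -> exists z r, [/\ gball t r z x, {subset E <= ball r z} &
      size (ball r z) <= 6 * size E]].
Proof.
have a0 : 0 < a by rewrite (leq_trans _ ha).
have b0 : 0 < b by rewrite (leq_trans _ hab).
have := exists_expn_gap m.+2 a0 hab => ex.
case: (ex_minnP ex) => k hk kmin {ex}.
case: k => [|k] in hk kmin.
  by move: hk; rewrite addn0 leqNgt expn0 -(expn0 a) ltn_exp2l.
have kk : b ^ k <= a ^ (m.+2 + k).
  by rewrite leqNgt; apply/negP => /ltnW /kmin; rewrite ltnn.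
pose R := m.+2 + k.+1; pose g1 := g ord_max.
have g1o : g1 != o by rewrite -(level_eq0 t) (level_g ht).
have g1b : b_side g1 = false.
  rewrite /b_side (level_g ht) /= (inj_eq (g_inj ht)); apply/negbTE.
  by rewrite -val_eqE /= -lt0n.
have g0o : g ord0 != o by rewrite -(level_eq0 t) (level_g ht).
exists (generation k.+1 (g ord0)), (generation (R + m) g1).
have sE : b ^ k.+1 <= size (generation k.+1 (g ord0)).
  by apply: (size_generation_ge_b ha hab ht); exact: (b_side_g0 ht).
split; [exact: generation_uniq o lf _ _|exact: generation_uniq o lf _ _| | |].
- by rewrite (leq_trans _ sE)// expn_gt0 b0.
- apply: (@leq_trans (m * b ^ k.+1)).
    by rewrite leq_mul2l (size_generation_le_b ha hab ht) orbT.
  rewrite expnS mulnCA leq_mul2l; apply/orP; right.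
  apply: leq_trans (size_generation_ge_a ha hab ht (R + m) g1).
  apply: (@leq_trans (a ^ m * a ^ (m.+2 + k))).
    by rewrite leq_mul// ltnW// ltn_expl.
  by rewrite -expnD leq_exp2l// /R; lia.
move=> x; rewrite (mem_generation o lf) addnC => /descendant_split[g1z zx].
set z := iter R parent x in g1z zx.
have lz : level z = m.+1 by rewrite (descendant_level g1z) (level_g ht).
have zb : ~~ b_side z by rewrite (b_side_descendant g g1o g1z) g1b.
exists z, R; split; first exact: descendant_gball zx.
- move=> y; rewrite (mem_generation o lf) => g0y; apply/(mem_gball lf).
  have oy : descendant (k.+1 + 1) o y.
    apply: descendant_add g0y.
    rewrite /descendant (level_g ht) level_root add0n eqxx andbT /=.
    apply/eqP/parentE; first by rewrite adj_sym; apply/(adj_root ht); exists ord0.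
    by rewrite (level_g ht) level_root.
  have oz : descendant m.+1 o z.
    have := @level_iter_parent _ t o (level z) z (leqnn _).
    rewrite subnn => /eqP; rewrite level_eq0 => /eqP e.
    by rewrite -lz -[X in descendant _ X _]e; exact: descendant_iter.
  have -> : R = m.+1 + (k.+1 + 1) by rewrite /R; lia.
  apply: gball_trans (descendant_gball oy).
  by apply: gball_symm; exact: descendant_gball oz.
- apply: leq_trans (size_gball_le (k := k.+1) zb _) _.
    by rewrite lz /R; lia.
  by have := hk; rewrite -/R; lia.
Qed.

Local Open Scope ring_scope.

(** The maximal function is linearised: the radius is an arbitrary function of the
    centre, and the bound does not depend on it. *)
Lemma Fab_strong_type (R : realType) (p : R) : 1 < p -> exists C : R, 0 <= C /\
  forall (f : V -> R) (N : R) (X : seq V) (r : V -> nat),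
  (forall x, 0 <= f x) ->
  (forall s, uniq s -> \sum_(y <- s) f y `^ p <= N) -> uniq X ->
  \sum_(x <- X) ((size (ball (r x) x))%:R^-1 * \sum_(y <- ball (r x) x) f y) `^ p
    <= C * N.
Proof.
move=> p1; eexists; split; last first.
  move=> f N X r f0 fN uX.
  pose u x := (size (ball (r x) x))%:R^-1 * \sum_(y <- ball (r x) x) f y.
  pose Y := undup (flatten [seq ball (r x) x | x <- X]).
  apply: (@le_trans _ _ (192 * (2 * 4 `^ (p - 1) * (1 - 2 `^ (1 - p))^-1)
      * \sum_(y <- Y) f y `^ p)).
    apply: (dyadic_interpolation (u := u)) => // [x|lam lam0].
      by rewrite mulr_ge0 ?invr_ge0// sumr_ge0.
    (* Restricting to [Y] changes no mean and leaves a finitely supported function. *)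
    pose h y := if (y \in Y) && (lam / 2 < f y) then f y else 0.
    have h0 y : 0 <= h y by rewrite /h; case: ifP.
    have l20 : 0 < lam / 2 by rewrite divr_gt0.
    suff : lam / 2 * (size [seq x <- X | lam < u x])%:R <=
        96 * \sum_(y <- Y | lam / 2 < f y) f y by lra.
    apply: (Fab_weak_type ha hab ht (h := h) (r := r)) => //.
    - move=> s us; rewrite /h -big_mkcond /= -big_filter -[leRHS]big_filter.
      apply: ler_sum_subseq => //; first exact: filter_uniq.
      by move=> y; rewrite !mem_filter -andbA => /and3P[-> -> _].
    - exact: filter_uniq.
    move=> x; rewrite mem_filter => /andP[lu xX].
    have B0 : 0 < (size (ball (r x) x))%:R :> R.
      rewrite ltr0n; have : x \in ball (r x) x by apply/(mem_gball lf); exact: gballxx.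
      by case: (ball _ _).
    have fh : \sum_(y <- ball (r x) x) f y <=
      \sum_(y <- ball (r x) x) (h y + lam / 2 * 1).
      rewrite big_seq [leRHS]big_seq; apply: ler_sum => y yB.
      have yY : y \in Y by rewrite mem_undup; apply/flatten_mapP; exists x.
      by rewrite /h yY /=; case: ltP => ?; lra.
    rewrite big_split -mulr_sumr -size_sum1 /= in fh.
    move: lu; rewrite /u mulrC ltr_pdivlMr//.
    by move: fh; set B : R := (size _)%:R; lra.
  apply: ler_wpM2l; last by apply: fN; exact: undup_uniq.
  rewrite !mulr_ge0 ?powR_ge0// invr_ge0 subr_ge0.
  by rewrite -[leRHS](powRr0 2) ler_powR ?ler1n// subr_le0 ltW.
rewrite /= !mulr_ge0 ?powR_ge0// invr_ge0 subr_ge0.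
by rewrite -[leRHS](powRr0 2) ler_powR ?ler1n// subr_le0 ltW.
Qed.

End Fab_maximal.

(** * Integrals against the counting measure *)

Section counting_integral.
Local Open Scope ring_scope.
Variables (R : realType) (V : pointedType).
Local Notation mu := (@card_measure R V).
Local Open Scope ereal_scope.

Lemma card_measure_finite (A : set V) : finite_set A ->
  mu A = (size (elements A))%:R%:E.
Proof. by move=> fA; rewrite /= /counting asboolT. Qed.

(** An infinite set has finite subsets of every size. *)
Lemma card_measure_le (A : set V) (c : R) :
  (forall s, uniq s -> [set` s] `<=` A -> ((size s)%:R <= c)%R) -> mu A <= c%:E.
Proof.
move=> sc; have [fA|iA] := pselect (finite_set A).
  rewrite card_measure_finite// lee_fin sc ?elements_uniq// => y /=.
  by rewrite mem_elements// => /asboolP.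
have [B BA cB] := infinite_set_fset (Num.truncn c).+1 iA.
have := sc (finmap.enum_fset B) (finmap.fset_uniq _) BA.
rewrite leNgt (lt_le_trans (truncnS_gt c))// ler_nat; exact: cB.
Qed.

Lemma integral_set1 (x : V) (F : discrete V -> \bar R) :
  \int[mu]_(y in [set x]) F y = F x.
Proof.
rewrite (eq_integral (cst (F x))); last by move=> y; rewrite inE => ->.
rewrite integral_cst// card_measure_finite//.
suff -> : elements [set x] = [:: x] by rewrite mule1.
apply: perm_small_eq => //; apply: uniq_perm; rewrite ?elements_uniq// => y.
by rewrite mem_elements// inE; apply/asboolP/eqP.
Qed.

Lemma integral_seq (s : seq V) (F : discrete V -> \bar R) :
  uniq s -> (forall x, 0 <= F x) ->
  \int[mu]_(y in [set` s]) F y = \sum_(y <- s) F y.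
Proof.
move=> us F0; have -> : [set` s] = \big[setU/set0]_(y <- s) [set y].
  by rewrite -bigcup_seq bigcup_imset1 image_id.
rewrite ge0_integral_bigsetU//; first by apply: eq_bigr => y _; exact: integral_set1.
by move=> x y _ _ [z [/= -> ->]].
Qed.

Lemma integral_finite (A : set V) (F : discrete V -> \bar R) : finite_set A ->
  (forall x, 0 <= F x) -> \int[mu]_(y in A) F y = \sum_(y <- elements A) F y.
Proof.
move=> fA F0; rewrite -integral_seq ?elements_uniq//; congr (integral _ _ _).
by apply/seteqP; split=> y /=; rewrite mem_elements// => /asboolP.
Qed.

Lemma sum_le_integral (s : seq V) (F : discrete V -> \bar R) :
  uniq s -> (forall x, 0 <= F x) -> \sum_(y <- s) F y <= \int[mu]_y F y.
Proof.
by move=> us F0; rewrite -integral_seq//; exact: ge0_subset_integral.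
Qed.

Variable t : tree V.
Hypothesis locally_finite : forall x, finite_set [set y | t x y].

(** The balls around a point are finite and exhaust the tree, whence the integral
    is a limit of finite sums. *)
Lemma integral_le (F : discrete V -> \bar R) (K : \bar R) :
  (forall x, 0 <= F x) -> (forall s : seq V, uniq s -> \sum_(y <- s) F y <= K) ->
  \int[mu]_y F y <= K.
Proof.
move=> F0 FK; pose o : V := point.
pose B n : set (discrete V) := gball t n o.
have -> : setT = \bigcup_n B n.
  by apply/seteqP; split => // y _; exists (gdist t o y) => //; exact: leqnn.
apply: (cvge_le _ (ge0_nondecreasing_set_cvg_integral _ _ _ _)) => //.
  apply: nearW => n; rewrite integral_finite//; last exact: finite_gball.
  by apply: FK; exact: elements_uniq.
by move=> m n mn; apply/subsetPset => y yB; exact: (leq_trans yB mn).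
Qed.

Definition ball_mean (f : V -> R) r x : R :=
  (size (elements (gball t r x)))%:R^-1 * \sum_(y <- elements (gball t r x)) `|f y|.

Lemma avg_gball (f : discrete V -> R) r x :
  avg f (gball t r x) = (ball_mean f r x)%:E.
Proof.
have fB := finite_gball locally_finite r x.
have : x \in elements (gball t r x) by apply/mem_gball => //; exact: gballxx.
rewrite /avg /ball_mean card_measure_finite// integral_finite//.
case: (elements _) => // y s _.
by rewrite inver /= pnatr_eq0/= EFinM sumEFin.
Qed.

Lemma lt_centred_max (f : discrete V -> R) x c :
  c < centred_max t f x -> exists r, c < (ball_mean f r x)%:E.
Proof. by move=> /ereal_sup_gt[_ [r _ <-]]; rewrite avg_gball => ?; exists r. Qed.

Lemma centred_max_ge0 (f : discrete V -> R) x : 0 <= centred_max t f x.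
Proof.
apply: ereal_sup_ge; exists (avg f (gball t 0 x)); first by exists 0%N.
by rewrite avg_gball lee_fin mulr_ge0// ?invr_ge0// sumr_ge0.
Qed.

Lemma uncentred_max_ge0 (f : discrete V -> R) x : 0 <= uncentred_max t f x.
Proof.
apply: ereal_sup_ge; exists (avg f (gball t 0 x)).
  by exists (x, 0%N) => //=; exact: gballxx.
by rewrite avg_gball lee_fin mulr_ge0// ?invr_ge0// sumr_ge0.
Qed.

End counting_integral.

(** * The maximal operators *)

Section maximal_bounds.
Local Open Scope ring_scope.
Local Open Scope ereal_scope.
Variables (R : realType) (a b : nat) (V : pointedType) (t : tree V) (o : V).
Variable g : 'I_a.+1 -> V.
Hypotheses (ha : (2 <= a)%N) (hab : (a < b)%N) (ht : is_Fab t a b o g).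
Local Notation mu := (@card_measure R V).
Local Notation lf := (Fab_locally_finite ht).
Local Notation M := (@centred_max R V t).
Local Notation N := (@uncentred_max R V t).

Lemma centred_weak_type : weak_type_1_1 M.
Proof.
exists 96%R => f lam fL lam0.
have Nfin : 'N[mu]_1[EFin \o f] \is a fin_num.
  rewrite ge0_fin_numE ?Lnorm_ge0//.
  by have := sub_Lfun_finLfun fL; rewrite inE.
rewrite -(fineK Nfin) -EFinM; apply: card_measure_le => s us sM.
rewrite mulrAC ler_pdivlMr// mulrC.
have /choice[r rP] : forall x, exists r, x \in s -> lam%:E < (ball_mean t f r x)%:E.
  move=> x; case: (boolP (x \in s)) => xs; last by exists 0%N.
  by have [r ?] := lt_centred_max lf (sM _ xs); exists r.
apply: (Fab_weak_type ha hab ht (h := fun y => `|f y|%R) (r := r)) => //.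
  move=> u uu; rewrite -lee_fin fineK// Lnorm1 -sumEFin.
  exact: (sum_le_integral (F := fun y => `|(f y)%:E|)).
move=> x xs; have := rP x xs; rewrite lte_fin /ball_mean mulrC ltr_pdivlMr//.
rewrite ltr0n; have : x \in elements (gball t (r x) x).
  by apply/(mem_gball lf); exact: gballxx.
by case: (elements _).
Qed.

(** The maximal function is finite everywhere, by the case of a single point, so
    at each vertex some radius achieves at least half of the supremum; this costs
    the factor [2 `^ p]. *)
Lemma centred_strong_type p : (1 < p)%R -> bounded_on_Lp M p.
Proof.
move=> p1; have p0 : (0 < p)%R by rewrite (lt_trans _ p1).
have [C [C0 CP]] := Fab_strong_type ha hab ht p1.
exists ((2 `^ p * C) `^ p^-1)%R => f fL.
set I := \int[mu]_y (`|(f y)%:E| `^ p).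
have I0 : 0 <= I by apply: integral_ge0 => y _; exact: poweR_ge0.
have Ifin : I \is a fin_num.
  rewrite ge0_fin_numE// (lty_poweRy (r := p^-1)) ?invr_neq0 ?gt_eqF//.
  by have := sub_Lfun_finLfun fL; rewrite inE /finite_norm /= unlock.
have sumf (s : seq V) : uniq s -> (\sum_(y <- s) `|f y| `^ p <= fine I)%R.
  move=> us; rewrite -lee_fin fineK// -sumEFin.
  apply: (sum_le_integral (F := fun y => `|(f y)%:E| `^ p)) => // y.
  exact: poweR_ge0.
pose A r x := ball_mean t f r x.
have A0 r x : (0 <= A r x)%R by rewrite mulr_ge0 ?invr_ge0// sumr_ge0.
have sumA (X : seq V) (r : V -> nat) : uniq X ->
    (\sum_(x <- X) A (r x) x `^ p <= C * fine I)%R.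
  by move=> uX; exact: (CP (fun y => `|f y|%R)).
have Mfin x : M f x \is a fin_num.
  rewrite ge0_fin_numE; last exact: centred_max_ge0 lf _ _.
  apply: (@le_lt_trans _ _ ((C * fine I) `^ p^-1)%R%:E); last exact: ltry.
  apply: ge_ereal_sup => _ [r _ <-]; rewrite (avg_gball lf) lee_fin.
  have := sumA [:: x] (fun=> r) isT; rewrite big_seq1 => h.
  rewrite -[leLHS](powRr1 (A0 r x)) -(@mulfV _ p) ?gt_eqF// powRrM.
  apply: ge0_ler_powR => //; rewrite ?nnegrE ?powR_ge0 ?invr_ge0 ?(ltW p0)//.
  exact: le_trans (powR_ge0 _ _) h.
have /choice[r rP] : forall x, exists r, (fine (M f x) <= 2 * A r x)%R.
  move=> x; have := centred_max_ge0 lf f x; rewrite -(fineK (Mfin x)) lee_fin.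
  rewrite le_eqVlt => /predU1P[<-|M0]; first by exists 0%N; rewrite mulr_ge0.
  have [|r] := @lt_centred_max _ _ _ lf f x (fine (M f x) / 2)%:E.
    by rewrite -[ltRHS](fineK (Mfin x)) lte_fin; lra.
  by rewrite lte_fin -/(A r x) => ?; exists r; lra.
have MI : \int[mu]_x (`|M f x| `^ p) <= (2 `^ p * C)%:E * I.
  apply: (integral_le lf) => [x|s us]; first exact: poweR_ge0.
  rewrite -(fineK Ifin) -EFinM -mulrA.
  apply: (@le_trans _ _ (\sum_(x <- s) (2 `^ p * A (r x) x `^ p)%:E)).
    apply: lee_sum => x _; rewrite -(fineK (Mfin x)) /= lee_fin.
    have M0 : (0 <= fine (M f x))%R by apply: fine_ge0; exact: centred_max_ge0 lf _ _.
    rewrite ger0_norm// -powRM ?A0//.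
    apply: ge0_ler_powR; [exact: ltW|by []| |exact: rP].
    by rewrite nnegrE mulr_ge0//; exact: A0.
  rewrite sumEFin lee_fin -mulr_sumr; apply: ler_wpM2l; first exact: powR_ge0.
  exact: sumA.
rewrite unlock /=.
rewrite -[X in _ <= X * _]poweR_EFin -poweRM//.
apply: gt0_ler_poweR => //.
- by rewrite invr_ge0 ltW.
- by rewrite in_itv/= leey andbT integral_ge0// => x _; exact: poweR_ge0.
- by rewrite in_itv/= leey andbT mule_ge0// lee_fin mulr_ge0 ?powR_ge0.
- by rewrite lee_fin mulr_ge0 ?powR_ge0.
Qed.

Lemma uncentred_unbounded p : (1 <= p)%R -> ~ bounded_on_Lp N p.
Proof.
move=> p1 [C CP]; have p0 : (0 < p)%R by rewrite (lt_le_trans _ p1).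
(* The witness of parameter [m] gives [m * |E| <= b * |F|], and the norm bound
   gives [|F| / 6 `^ p <= |C| `^ p * |E|], so that [m <= D]. *)
pose D : R := (b%:R * (6 `^ p * `|C| `^ p))%R.
have D0 : (0 <= D)%R by rewrite !mulr_ge0 ?powR_ge0.
have [E [F [uE uF E0 EF FP]]] := uncentred_witness ha hab ht (Num.truncn D).+1.
pose f : discrete V -> R := fun y => (y \in E)%:R.
have If : \int[mu]_y (`|(f y)%:E| `^ p) <= (size E)%:R%:E.
  apply: (integral_le lf) => [y|s us]; first exact: poweR_ge0.
  rewrite (eq_bigr (fun y => (f y)%:E)); last first.
    move=> y _; rewrite /f /=; case: (y \in E).
      by rewrite normr1 powR1.
    by rewrite normr0 powR0// gt_eqF.
  rewrite sumEFin lee_fin -natr_sum ler_nat -big_mkcond/= sum1_count -size_filter.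
  apply: uniq_leq_size; first exact: filter_uniq.
  by move=> y; rewrite mem_filter => /andP[].
have fL : f \in Lfun mu p%:E.
  rewrite inE; apply/andP; split; rewrite inE//=.
  rewrite /finite_norm unlock poweR_lty//; exact: le_lt_trans If (ltry _).
have := CP f fL => {}CP.
have {}CP : 'N[mu]_p%:E[N f] <= `|C|%:E * 'N[mu]_p%:E[EFin \o f].
  apply: le_trans CP _; apply: lee_wpmul2r; first exact: Lnorm_ge0.
  by rewrite lee_fin ler_norm.
have NI : \int[mu]_x (`|N f x| `^ p) <= (`|C| `^ p)%:E * (size E)%:R%:E.
  rewrite -poweR_Lnorm ?gt_eqF//.
  apply: (@le_trans _ _ ((`|C|%:E * 'N[mu]_p%:E[EFin \o f]) `^ p)).
    apply: gt0_ler_poweR => //; first exact: ltW.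
      by rewrite in_itv/= leey andbT Lnorm_ge0.
    by rewrite in_itv/= leey andbT mule_ge0 ?Lnorm_ge0.
  rewrite poweRM ?Lnorm_ge0// poweR_Lnorm ?gt_eqF//; apply: lee_wpmul2l => //.
  exact: poweR_ge0.
have FN : ((size F)%:R * 6^-1 `^ p)%:E <= \int[mu]_x (`|N f x| `^ p).
  apply: le_trans (sum_le_integral uF _); last by move=> x; exact: poweR_ge0.
  rewrite size_sum1 mulr_suml -sumEFin big_seq [leRHS]big_seq.
  apply: lee_sum => x /FP[z [r [zx EB sB]]].
  rewrite mul1r -poweR_EFin; apply: gt0_ler_poweR => //; first exact: ltW.
  - by rewrite in_itv/= leey andbT lee_fin.
  - by rewrite in_itv/= leey andbT.
  rewrite gee0_abs; last exact: uncentred_max_ge0 lf _ _.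
  apply: ereal_sup_ge; exists (avg f (gball t r z)); first by exists (z, r).
  rewrite (avg_gball lf) lee_fin /ball_mean.
  have B0 : (0 < (size (elements (gball t r z)))%:R :> R)%R.
    by rewrite ltr0n (leq_trans E0)// uniq_leq_size.
  rewrite mulrC ler_pdivlMr// mulrC ler_pdivrMr//.
  apply: (@le_trans _ _ (size E * 6)%:R%R); first by rewrite ler_nat mulnC.
  rewrite natrM ler_wpM2r// size_sum1.
  rewrite [leLHS](_ : _ = \sum_(y <- E) `|f y|)%R; last first.
    by rewrite big_seq [RHS]big_seq; apply: eq_bigr => y yE; rewrite /f yE normr1.
  exact: ler_sum_subseq.
have := le_trans FN NI; rewrite -EFinM lee_fin => FE.
have : ((Num.truncn D).+1%:R * (size E)%:R <= D * (size E)%:R)%R.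
  apply: (@le_trans _ _ (b%:R * (size F)%:R)%R).
    by rewrite -!natrM ler_nat.
  have -> : ((size F)%:R = 6 `^ p * ((size F)%:R * 6^-1 `^ p) :> R)%R.
    by rewrite mulrCA -powRM// mulfV// powR1 mulr1.
  rewrite /D -!mulrA; apply: ler_wpM2l => //.
  by apply: ler_wpM2l; rewrite ?powR_ge0.
rewrite ler_pM2r ?ltr0n//; apply/negP; rewrite -ltNge; exact: truncnS_gt.
Qed.

End maximal_bounds.

Local Close Scope classical_set_scope.

Theorem theorem4p1 (R : realType) (a b : nat) (ha : (2 <= a)%N) (hab : (a < b)%N)
    (V : pointedType) (t : tree V) (o : V) (g : 'I_a.+1 -> V)
    (ht : is_Fab t a b o g) :
  (forall p : R, (1 <= p)%R -> ~ bounded_on_Lp (@uncentred_max R V t) p) /\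
  ((forall p : R, (1 < p)%R -> bounded_on_Lp (@centred_max R V t) p) /\
   weak_type_1_1 (@centred_max R V t)).
Proof.
split=> [p|]; first exact: (uncentred_unbounded ha hab ht).
split=> [p|]; first exact: (centred_strong_type ha hab ht).
exact: (centred_weak_type R ha hab ht).
Qed.
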